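(* In the Nash equilibrium setting of the context, the following hold. (i) $\nabla_{\mathbf{x}}V_\alpha(\mathbf{x})$ is given by $\nabla_{\mathbf{x}}V_\alpha(\mathbf{x})=\nabla_{\mathbf{x}}\Psi_\alpha(\mathbf{x},\mathbf{y})\big|_{\mathbf{y}=\mathbf{y}_\alpha(\mathbf{x})}$, where $$\nabla_{\mathbf{x}}V_\alpha(\mathbf{x})=\sum_{\nu=1}^N\big[\nabla_{\mathbf{x}}\theta_\nu(\mathbf{x}^\nu,\mathbf{x}^{-\nu})-\nabla_{\mathbf{x}}\theta_\nu(\mathbf{y}_\alpha^\nu(\mathbf{x}),\mathbf{x}^{-\nu})\big]+\begin{bmatrix}\nabla_{\mathbf{x}^1}\theta_1(\mathbf{y}_\alpha^1(\mathbf{x}),\mathbf{x}^{-1})\\ \vdots\\ \nabla_{\mathbf{x}^N}\theta_N(\mathbf{y}_\alpha^N(\mathbf{x}),\mathbf{x}^{-N})\end{bmatrix}-\alpha(\mathbf{x}-\mathbf{y}_\alpha(\mathbf{x})).$$ (ii) The function $V_\alpha$ is $L_0^{V_\alpha}$-Lipschitz on $\mathcal{X}$, i.e., for any $\mathbf{u},\mathbf{v}\in\mathcal{X}$, $\|V_\alpha(\mathbf{u})-V_\alpha(\mathbf{v})\|\le L_0^{V_\alpha}\|\mathbf{u}-\mathbf{v}\|$, where $$L_0^{V_\alpha}\triangleq\sum_{\nu=1}^N\Big(L_0^\nu\big(1+\sqrt{1+(L_0^{\mathbf{y}_\alpha})^2}\big)+4\alpha C^\nu(1+L_0^{\mathbf{y}_\alpha})\Big)$$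 and $C^\nu$ is the diameter of the set $\mathcal{X}^\nu$. (iii) The function $V_\alpha$ is $L_1^{V_\alpha}$-smooth on $\mathcal{X}$, i.e., for any $\mathbf{u},\mathbf{v}\in\mathcal{X}$, $\|\nabla_{\mathbf{x}}V_\alpha(\mathbf{u})-\nabla_{\mathbf{x}}V_\alpha(\mathbf{v})\|\le L_1^{V_\alpha}\|\mathbf{u}-\mathbf{v}\|$, where $$L_1^{V_\alpha}\triangleq2\sum_{\nu=1}^N\Big(L_1^\nu+L_1^\nu\sqrt{1+(L_0^{\mathbf{y}_\alpha})^2}\Big)+\alpha(1+L_0^{\mathbf{y}_\alpha}).$$
   Context: There are $N$ players; player $\nu$ has strategy $\mathbf{x}^\nu\in\mathcal{X}^\nu\subseteq\mathbb{R}^{n_\nu}$, $\sum_\nu n_\nu=n$, $\mathcal{X}=\prod_\nu\mathcal{X}^\nu$; $\mathbf{x}=(\mathbf{x}^\nu,\mathbf{x}^{-\nu})$ with $\mathbf{x}^{-\nu}$ the rivals' strategies (no reordering of coordinates). Player $\nu$ has cost $\theta_\nu:\mathbb{R}^n\to\mathbb{R}$ (an expectation $\theta_\nu(\mathbf{x})=\mathbb{E}[\tilde\theta_\nu(\mathbf{x},\boldsymbol{\xi})]$). For each $\nu$: $\theta_\nu(\cdot,\mathbf{x}^{-\nu})$ is convex on $\mathcal{X}^\nu$ for every $\mathbf{x}^{-\nu}\in\mathcal{X}^{-\nu}$; $\theta_\nu$ is $L_0^\nu$-Lipschitz and $L_1^\nu$-smooth on $\mathcal{X}$ (i.e. continuously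 differentiable with $L_1^\nu$-Lipschitz gradient); $\mathcal{X}^\nu$ is compact and convex. In the formulas of the claim, $\nabla_{\mathbf{x}}\theta_\nu(\mathbf{y}^\nu,\mathbf{x}^{-\nu})$ denotes the full gradient of $\theta_\nu$ in $\mathbb{R}^n$ evaluated at the point with $\nu$-block $\mathbf{y}^\nu$ and other blocks $\mathbf{x}^{-\nu}$, and $\nabla_{\mathbf{x}^\nu}\theta_\nu$ is its $\nu$-th block. For a scalar $\alpha>0$ define $\Psi_\alpha(\mathbf{x},\mathbf{y})=\sum_{\nu=1}^N[\theta_\nu(\mathbf{x}^\nu,\mathbf{x}^{-\nu})-\theta_\nu(\mathbf{y}^\nu,\mathbf{x}^{-\nu})-\frac{\alpha}{2}\|\mathbf{x}^\nu-\mathbf{y}^\nu\|^2]$ and $V_\alpha(\mathbf{x})=\sup_{\mathbf{y}\in\mathcal{X}}\Psi_\alpha(\mathbf{x},\mathbf{y})$ for $\mathbf{x}\in\mathcal{X}$. The supremum is attained at the unique $\mathbf{y}_\alpha(\mathbf{x})=(\mathbf{y}_\alpha^\nu(\mathbf{x}))_{\nu=1}^N$, $\mathbf{y}_\alpha^\nu(\mathbf{x})=\arg\min_{\mathbf{y}^\nu\in\mathcal{X}^\nu}[\theta_\nu(\mathbf{y}^\nu,\mathbf{x}^{-\nu})+\frac{\alpha}{2}\|\mathbf{x}^\nu-\mathbf{y}^\nu\|^2]$. $L_0^{\mathbf{y}_\alpha}$ denotes the Lipschitz constant of the maps $\mathbf{y}_\alpha^\nu(\cdot)$, i.e. $\|\mathbf{y}_\alpha^\nu(\mathbf{x}_1)-\mathbf{y}_\alpha^\nu(\mathbf{x}_2)\|\le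 L_0^{\mathbf{y}_\alpha}\|\mathbf{x}_1-\mathbf{x}_2\|$ for any $\mathbf{x}_1,\mathbf{x}_2\in\mathcal{X}$; its value is $\frac{\alpha+L_G^\nu}{\alpha-L_G^\nu}$ for $\alpha>L_G^\nu$, with $L_G^\nu$ the Lipschitz constant of $\nabla_{\mathbf{x}^\nu}\theta_\nu$. *)

(* Defs.v *)
From HB Require Import structures.
From mathcomp Require Import all_boot all_order all_algebra.
From mathcomp Require Import all_classical all_reals all_analysis.

Set Implicit Arguments.
Unset Strict Implicit.
Unset Printing Implicit Defensive.

Import Order.TTheory GRing.Theory Num.Theory.
Import numFieldNormedType.Exports.

Local Open Scope classical_set_scope.
Local Open Scope ring_scope.

(* The canonical norm `|x| on 'rV[R]_m is the sup norm, and the library's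
   lipschitz predicates use it; every norm in the statement is Euclidean. *)
Definition enorm (R : realType) m (x : 'rV[R]_m) : R :=
  Num.sqrt (\sum_i x 0 i ^+ 2).

Definition ediam (R : realType) m (A : set 'rV[R]_m) : R :=
  sup [set enorm (p.1 - p.2) | p in A `*` A].

Definition elipschitz (R : realType) m k (L : R) (A : set 'rV[R]_m)
    (f : 'rV[R]_m -> 'rV[R]_k) : Prop :=
  forall u v, A u -> A v -> enorm (f u - f v) <= L * enorm (u - v).

Definition elipschitz_fun (R : realType) m (L : R) (A : set 'rV[R]_m)
    (f : 'rV[R]_m -> R) : Prop :=
  forall u v, A u -> A v -> `|f u - f v| <= L * enorm (u - v).

Definition grad (R : realType) m (f : 'rV[R]_m -> R) (x : 'rV[R]_m) : 'rV[R]_m :=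
  \row_i 'D_(delta_mx 0 i) f x.

(* The sets A used below are closed, possibly with empty interior; "C^1 on A"
   means C^1 on some open set containing A. *)
Definition C1_on (R : realType) m (A : set 'rV[R]_m) (f : 'rV[R]_m -> R) : Prop :=
  exists U : set 'rV[R]_m, [/\ open U, A `<=` U,
    (forall x, U x -> differentiable f x) &
    (forall x, U x -> {for x, continuous (grad f)})].

Definition smooth_on (R : realType) m (L : R) (A : set 'rV[R]_m)
    (f : 'rV[R]_m -> R) : Prop :=
  C1_on A f /\ elipschitz L A (grad f).

Section Game.
Context {R : realType} {N : nat} {n : 'I_N -> nat}.

(* R^n with n = n_1 + ... + n_N; submxrow x nu is the block x^nu. *)
Definition profile := 'rV[R]_(\sum_(nu < N) n nu)%N.

Implicit Types (x y : profile) (X : forall nu, set 'rV[R]_(n nu))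
  (theta : 'I_N -> profile -> R) (alpha : R).

(* The point (z, x^{-nu}): x with its nu-th block replaced by z. *)
Definition deviate x nu (z : 'rV[R]_(n nu)) : profile :=
  \mxrow_mu eqtype.dfwith (fun k => submxrow x k) z mu.

Definition profiles X : set profile := [set x | forall nu, X nu (submxrow x nu)].

Definition Psi theta alpha x y : R :=
  \sum_nu (theta nu x - theta nu (deviate x (submxrow y nu))
           - alpha / 2 * enorm (submxrow x nu - submxrow y nu) ^+ 2).

(* The same supremum formula is used for every x in R^n, so that the gradient
   of V at a boundary point of the strategy set is meaningful. *)
Definition V theta X alpha x : R :=
  sup [set Psi theta alpha x y | y in profiles X].

Definition regularized theta alpha x nu (z : 'rV[R]_(n nu)) : R :=
  theta nu (deviate x z) + alpha / 2 * enorm (submxrow x nu - z) ^+ 2.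

Definition yblock theta X alpha nu x : 'rV[R]_(n nu) :=
  xget 0 [set z | X nu z /\
    forall w, X nu w -> regularized theta alpha x z <= regularized theta alpha x w].

Definition ybest theta X alpha x : profile := \mxrow_nu yblock theta X alpha nu x.

(* Any function of the rivals' strategies is encoded with a full profile x
   whose nu-th block is irrelevant. *)
Definition player_convex X (nu : 'I_N) (f : profile -> R) : Prop :=
  forall x, (forall mu, mu != nu -> X mu (submxrow x mu)) ->
    convex_function (X nu) (fun z => f (deviate x z) : R^o).

End Game.

Arguments profile R {N} n.

(* Main.v *)
(* Part (i) is Danskin's theorem: the maximizer of Psi(x, .) over the compact set of profiles
   is unique, since each player minimizes a convex cost plus a strictly convex penalty, and the
   costs are C^1 near the profiles, hence strictly differentiable, so that Psi is differentiable
   in x uniformly in y near the maximizer.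

   The Lipschitz estimates of ya and of grad V rest on the variational inequality
   <g_nu + alpha (y^nu - x^nu), w^nu - y^nu> >= 0 at y = ya x, where g_nu is the nu-th block of
   the gradient of theta_nu at (y^nu, x^{-nu}). Adding it for two profiles u and v bounds the
   variation of ya. For (iii), it shows that alpha (x - y) - g varies at most as much as
   alpha x - g, so the map ya, whose blocks only are assumed Ly-Lipschitz, does not cost a
   factor sqrt N. Part (ii) only compares Psi(u, y) with Psi(v, y) at a maximizer y.

   The constants L0, L1, Ly and LG may be negative, but only if no two distinct profiles
   exist. *)

Require Import Defs.
From HB Require Import structures.
From mathcomp Require Import all_boot all_order all_algebra.
From mathcomp Require Import all_classical all_reals all_analysis.
From mathcomp Require Import ring lra.

Set Implicit Arguments.
Unset Strict Implicit.
Unset Printing Implicit Defensive.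

Import Order.TTheory GRing.Theory Num.Theory.
Import numFieldNormedType.Exports.

Local Open Scope classical_set_scope.
Local Open Scope ring_scope.

(** * Euclidean inner product and norm, compared with the sup norm *)

Section Euclidean.
Context {R : realType} {m : nat}.
Implicit Types u v w : 'rV[R]_m.

Definition dot u v : R := \sum_i u 0 i * v 0 i.

Lemma dotC u v : dot u v = dot v u.
Proof. by apply: eq_bigr => i _; rewrite mulrC. Qed.

Lemma dotDl u v w : dot (u + v) w = dot u w + dot v w.
Proof. by rewrite -big_split; apply: eq_bigr => i _; rewrite mxE mulrDl. Qed.

Lemma dotZl a u v : dot (a *: u) v = a * dot u v.
Proof. by rewrite mulr_sumr; apply: eq_bigr => i _; rewrite mxE mulrA. Qed.

Lemma dotNl u v : dot (- u) v = - dot u v.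
Proof. by rewrite -scaleN1r dotZl mulN1r. Qed.

Lemma dotBl u v w : dot (u - v) w = dot u w - dot v w.
Proof. by rewrite dotDl dotNl. Qed.

Lemma dotDr u v w : dot u (v + w) = dot u v + dot u w.
Proof. by rewrite dotC dotDl !(dotC _ u). Qed.

Lemma dotZr a u v : dot u (a *: v) = a * dot u v.
Proof. by rewrite dotC dotZl dotC. Qed.

Lemma dotNr u v : dot u (- v) = - dot u v.
Proof. by rewrite dotC dotNl dotC. Qed.

Lemma dotBr u v w : dot u (v - w) = dot u v - dot u w.
Proof. by rewrite dotDr dotNr. Qed.

Lemma dot0l u : dot 0 u = 0.
Proof. by rewrite -(scale0r 0) dotZl mul0r. Qed.

Lemma dot_suml (I : finType) (F : I -> 'rV[R]_m) u :
  dot (\sum_i F i) u = \sum_i dot (F i) u.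
Proof. exact: (big_morph (dot^~ u) (fun v w => dotDl v w u) (dot0l u)). Qed.

Lemma dot_ge0 u : 0 <= dot u u.
Proof. by apply: sumr_ge0 => i _; rewrite -expr2 sqr_ge0. Qed.

Lemma dot_eq0 u : dot u u = 0 -> u = 0.
Proof.
move=> /eqP; rewrite psumr_eq0; last by move=> i _; rewrite -expr2 sqr_ge0.
by move=> /allP u0; apply/rowP => i; have := u0 i; rewrite mem_index_enum mxE => /(_ isT) /=;
   rewrite mulf_eq0 orbb => /eqP.
Qed.

Lemma enorm_sqr u : enorm u ^+ 2 = dot u u.
Proof.
rewrite /enorm sqr_sqrtr; first by apply: eq_bigr => i _; rewrite expr2.
by apply: sumr_ge0 => i _; rewrite sqr_ge0.
Qed.

Lemma enorm_ge0 u : 0 <= enorm u.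
Proof. exact: sqrtr_ge0. Qed.

Lemma enorm0 : enorm (0 : 'rV[R]_m) = 0.
Proof. by apply/eqP; rewrite -sqrf_eq0 enorm_sqr dot0l. Qed.

Lemma enorm_eq0 u : enorm u = 0 -> u = 0.
Proof. by move=> u0; apply: dot_eq0; rewrite -enorm_sqr u0 expr0n. Qed.

Lemma enormZ a u : enorm (a *: u) = `|a| * enorm u.
Proof.
apply/eqP; rewrite -(eqrXn2 (n := 2)) ?mulr_ge0 ?enorm_ge0//.
by rewrite exprMn !enorm_sqr dotZl dotZr real_normK ?num_real// expr2 mulrA.
Qed.

Lemma enormN u : enorm (- u) = enorm u.
Proof. by rewrite -scaleN1r enormZ normrN1 mul1r. Qed.

Lemma enormBC u v : enorm (u - v) = enorm (v - u).
Proof. by rewrite -enormN opprB. Qed.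

(** Cauchy-Schwarz: the square of [(v.v) u - (u.v) v] is nonnegative and equals [v.v] times the
    defect. *)
Lemma ler_dot u v : dot u v <= enorm u * enorm v.
Proof.
have [->|v0] := eqVneq v 0; first by rewrite dotC dot0l enorm0 mulr0.
have vv : 0 < dot v v.
  by rewrite lt_def dot_ge0 andbT; apply: contra_neq v0; exact: dot_eq0.
apply: le_trans (ler_norm _) _.
rewrite -(ler_pXn2r (n := 2)) ?nnegrE ?mulr_ge0 ?enorm_ge0//.
rewrite exprMn !enorm_sqr real_normK ?num_real//.
have := dot_ge0 (dot v v *: u - dot u v *: v).
rewrite dotBl !dotBr !dotZl !dotZr (dotC v u) => H.
have : 0 <= dot v v * (dot u u * dot v v - dot u v ^+ 2) by apply: le_trans H _; lra.
by rewrite pmulr_rge0// subr_ge0.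
Qed.

Lemma ler_enormD u v : enorm (u + v) <= enorm u + enorm v.
Proof.
rewrite -(ler_pXn2r (n := 2)) ?nnegrE ?addr_ge0 ?enorm_ge0//.
rewrite sqrrD !enorm_sqr dotDl !dotDr (dotC v u).
have := ler_dot u v; lra.
Qed.

Lemma ler_enormB u v : enorm (u - v) <= enorm u + enorm v.
Proof. by rewrite -(enormN v) ler_enormD. Qed.

(** Expand the square of [u = (u - v) + v]. This is what makes [z - P z] nonexpansive for a
    projection [P]. *)
Lemma ler_enorm_monotone u v : 0 <= dot (u - v) v -> enorm (u - v) <= enorm u.
Proof.
move=> uv; rewrite -(ler_pXn2r (n := 2)) ?nnegrE ?enorm_ge0// !enorm_sqr.
rewrite -[in leRHS](subrK v u); move: (u - v) uv => w wv.
have := dot_ge0 v; rewrite !dotDl !dotDr (dotC v w); lra.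
Qed.

Lemma ler_enorm_sum (I : finType) (F : I -> 'rV[R]_m) :
  enorm (\sum_i F i) <= \sum_i enorm (F i).
Proof.
elim/big_ind2 : _ => [|x a y b xa yb|//]; first by rewrite enorm0.
by apply: le_trans (ler_enormD _ _) _; exact: lerD.
Qed.

Lemma ler_coord u i : `|u 0 i| <= `|u|.
Proof.
rewrite [leRHS]/Num.norm /= mx_normrE.
by apply/bigmax_geP; right => /=; exists (0, i).
Qed.

Lemma ler_mx_norm u e : 0 <= e -> (forall i, `|u 0 i| <= e) -> `|u| <= e.
Proof.
move=> e0 ue; rewrite [leLHS]/Num.norm /= mx_normrE.
by apply/bigmax_leP; split=> // -[i j] _; rewrite (ord1 i).
Qed.

Lemma ler_dot_norm u v : `|dot u v| <= m%:R * `|u| * `|v|.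
Proof.
apply: le_trans (ler_norm_sum _ _ _) _.
have : \sum_(i < m) (`|u| * `|v|) = m%:R * `|u| * `|v|.
  by rewrite sumr_const card_ord -mulrA mulr_natl.
move=> <-; apply: ler_sum => i _.
by rewrite normrM ler_pM// ler_coord.
Qed.

(** A crude constant suffices to see that diameters are finite; [m + 1] avoids a square root, since
    [m <= (m + 1)^2]. *)
Lemma ler_enorm_norm u : enorm u <= (m%:R + 1) * `|u|.
Proof.
have m1 : (0 : R) <= m%:R + 1 by rewrite addr_ge0.
rewrite -(ler_pXn2r (n := 2)) ?nnegrE ?mulr_ge0 ?enorm_ge0//.
rewrite enorm_sqr; apply: le_trans (ler_norm _) _; apply: le_trans (ler_dot_norm _ _) _.
rewrite -mulrA exprMn -expr2 ler_wpM2r ?sqr_ge0//.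
by have : (0 : R) <= m%:R by []; nra.
Qed.

End Euclidean.

(** * Frechet and strict differentiability in terms of gradients *)

Section Gradients.
Context {R : realType} {m : nat}.
Implicit Types (f : 'rV[R]_m -> R) (x p G u v : 'rV[R]_m).

Lemma dot_is_linear G : linear (dot G : 'rV[R]_m -> R^o).
Proof. by move=> a u v; rewrite dotDr dotZr. Qed.

HB.instance Definition _ G :=
  GRing.isLinear.Build R 'rV[R]_m R^o _ (dot G) (dot_is_linear G).

Lemma dot_continuous G : continuous (dot G : 'rV[R]_m -> R).
Proof.
move=> u; apply/(@cvgrPdist_le _ R^o _ (nbhs u) _) => e e0.
have c0 : 0 < m%:R * `|G| + 1 by rewrite ltr_wpDl// mulr_ge0.
apply/nbhs_ballP; exists (e / (m%:R * `|G| + 1)) => /= [|v]; first exact: divr_gt0.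
rewrite -ball_normE /= ltr_pdivlMr// => /ltW vu.
rewrite -dotBr; apply: le_trans (ler_dot_norm _ _) _.
by apply: le_trans _ vu; rewrite mulrC ler_wpM2l// lerDl.
Qed.

(** Frechet differentiability with an explicit gradient. The sup norm is harmless here, all norms
    being equivalent. *)
Definition has_grad f x G := forall e : R, 0 < e ->
  exists2 d : R, 0 < d &
    forall h : 'rV[R]_m, `|h| < d -> `|f (x + h) - f x - dot G h| <= e * `|h|.

(** Uniqueness of the differential identifies ['d f x] with [dot G]; the unit vectors then give the
    partial derivatives. *)
Lemma has_grad_grad f x G : has_grad f x G -> differentiable f x /\ grad f x = G.
Proof.
move=> fG.
pose F : 'rV[R]_m -> R^o := fun h => f (h + x).
pose L : 'rV[R]_m -> R^o := cst (f x : R^o) + (dot G : 'rV[R]_m -> R^o).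
have fo : F = L +o_ (0 : 'rV[R]_m) id.
  apply/(@eqaddoP _ _ _ _ (nbhs (0 : 'rV[R]_m)) _ L id) => e e0.
  have [d d0 fd] := fG _ e0.
  apply/nbhs_ballP; exists d => //= h; rewrite -ball_normE /= sub0r normrN => hd.
  by have := fd h hd; rewrite /F /L !fctE /= (addrC h x) opprD addrA.
have dfG : 'd f x = dot G :> ('rV[R]_m -> R).
  by apply: diff_unique fo; exact: dot_continuous.
have df : differentiable f x.
  by apply/diff_locallyP; rewrite dfG; split => //; exact: dot_continuous.
split => //; apply/rowP => i; rewrite mxE deriveE// dfG.
rewrite /dot (bigD1 i)//= big1 ?mxE ?eqxx ?mulr1 ?addr0// => j ji.
by rewrite mxE (negbTE ji) mulr0.
Qed.

Lemma diff_dot_grad f x v : differentiable f x -> 'D_v f x = dot (grad f x) v.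
Proof.
move=> df; rewrite deriveE// [in LHS](row_sum_delta v) linear_sum.
by apply: eq_bigr => i _; rewrite linearZ /= mxE deriveE// mulrC.
Qed.

(** Strict differentiability: both endpoints move freely near [p]. This yields estimates uniform in
    [y] when the base point of an increment depends on [y]. *)
Definition strict_grad f p G := forall e : R, 0 < e ->
  exists2 d : R, 0 < d & forall a b : 'rV[R]_m, `|a - p| < d -> `|b - p| < d ->
    `|f a - f b - dot G (a - b)| <= e * `|a - b|.

(** The difference quotient along the line is literally that of [f] at [b + t *: v] in direction
    [v]. *)
Lemma is_derive_segment f b v (t : R) : differentiable f (b + t *: v) ->
  is_derive t 1 (fun s : R => f (b + s *: v)) (dot (grad f (b + t *: v)) v).
Proof.
move=> df; pose g := fun s : R => f (b + s *: v).
have E : (fun h : R => h^-1 *: ((g \o shift t) (h *: 1) - g t)) =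
    (fun h : R => h^-1 *: ((f \o shift (b + t *: v)) (h *: v) - f (b + t *: v))).
  apply/funext => h; rewrite /g /= -[h *: 1]/(h * 1) mulr1.
  by rewrite scalerDl addrCA.
rewrite -diff_dot_grad//; apply: DeriveDef; last by rewrite /derive E.
by have : derivable f (b + t *: v) v := diff_derivable df; rewrite /derivable E.
Qed.

(* Mean value theorem on the segment [b, a], along which the gradient is close to its value at p. *)
Lemma C1_strict_grad f (U : set 'rV[R]_m) p :
  open U -> U p -> (forall x, U x -> differentiable f x) ->
  {for p, continuous (grad f)} -> strict_grad f p (grad f p).
Proof.
move=> oU Up dU cg e e0.
have m1 : (0 : R) < m%:R + 1 by rewrite ltr_wpDl.
have /nbhs_ballP[r1 /= r10 r1U] : nbhs p U by exact: open_nbhs_nbhs.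
have : \forall z \near p, `|grad f p - grad f z| <= e / (m%:R + 1).
  by move/cvgrPdist_le : cg; apply; rewrite divr_gt0.
move=> /nbhs_ballP[r2 /= r20 r2g].
exists (Num.min r1 r2); first by rewrite lt_min r10 r20.
move=> a b ap bp.
have seg (t : R) : 0 <= t <= 1 -> `|b + t *: (a - b) - p| < Num.min r1 r2.
  move=> /andP[t0 t1].
  have -> : b + t *: (a - b) - p = t *: (a - p) + (1 - t) *: (b - p).
    by apply/rowP => i; rewrite !mxE; ring.
  apply: le_lt_trans (ler_normD _ _) _; rewrite !normrZ (ger0_norm t0) ger0_norm ?subr_ge0//.
  (* Strictness comes from the [a] part when [t] is nonzero; at [t = 0] only the [b] part is
     left. *)
  have [->|tn0] := eqVneq t 0; first by rewrite mul0r add0r subr0 mul1r.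
  have : 0 < t * (Num.min r1 r2 - `|a - p|) by rewrite mulr_gt0 ?subr_gt0// lt_def tn0.
  have : 0 <= (1 - t) * (Num.min r1 r2 - `|b - p|) by rewrite mulr_ge0 ?subr_ge0// ltW.
  lra.
have segU (t : R) : 0 <= t <= 1 -> U (b + t *: (a - b)).
  move=> t01; apply: r1U; rewrite -ball_normE /= distrC.
  by apply: lt_le_trans (seg _ t01) _; rewrite ge_min lexx.
have dg (t : R) : 0 <= t <= 1 -> is_derive t (1 : R) (fun s : R => f (b + s *: (a - b)))
    (dot (grad f (b + t *: (a - b))) (a - b)).
  by move=> t01; apply/is_derive_segment/dU/segU.
pose g (s : R) : R := f (b + s *: (a - b)).
have gder (t : R) : t \in `]0, 1[ -> is_derive t 1 g (dot (grad f (b + t *: (a - b))) (a - b)).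
  by rewrite in_itv /= => /andP[t0 t1]; apply: dg; rewrite !ltW.
have gcont : {within `[0, 1], continuous g}.
  apply: derivable_within_continuous => t; rewrite in_itv /= => t01.
  by have [] := dg _ t01.
have [c] := MVT_segment ler01 gder gcont.
rewrite in_itv /= => c01; rewrite /g scale1r scale0r addr0 subr0 mulr1.
have -> : b + (a - b) = a by rewrite addrC subrK.
move=> ->.
rewrite -dotBl; apply: le_trans (ler_dot_norm _ _) _.
rewrite ler_wpM2r//; have : `|grad f (b + c *: (a - b)) - grad f p| <= e / (m%:R + 1).
  rewrite distrC; apply: r2g; rewrite -ball_normE /= distrC.
  by apply: lt_le_trans (seg _ c01) _; rewrite ge_min lexx orbT.
rewrite ler_pdivlMr// mulrC mulrDl mul1r; apply: le_trans.
by rewrite lerDl.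
Qed.

Lemma strict_grad_has_grad f p G : strict_grad f p G -> has_grad f p G.
Proof.
move=> fG e e0; have [d d0 fd] := fG _ e0; exists d => // h hd.
have := fd (p + h) p; rewrite (addrC p h) addrK subrr normr0 addrC; exact.
Qed.

Lemma strict_gradD f g p G H : strict_grad f p G -> strict_grad g p H ->
  strict_grad (fun z => f z + g z) p (G + H).
Proof.
move=> fG gH e e0; have e20 : 0 < e / 2 by rewrite divr_gt0.
have [d1 d10 fd] := fG _ e20; have [d2 d20 gd] := gH _ e20.
exists (Num.min d1 d2) => [|a b]; first by rewrite lt_min d10.
rewrite !lt_min => /andP[a1 a2] /andP[b1 b2].
have := fd a b a1 b1; have := gd a b a2 b2; rewrite dotDl !ler_norml; lra.
Qed.

Lemma strict_gradZ (c : R) f p G : strict_grad f p G ->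
  strict_grad (fun z => c * f z) p (c *: G).
Proof.
move=> fG e e0; have c0 : 0 < `|c| + 1 by rewrite ltr_wpDl.
have [|d d0 fd] := fG (e / (`|c| + 1)); first exact: divr_gt0.
exists d => // a b ad bd; have := fd a b ad bd.
rewrite dotZl -!mulrBr normrM => H.
apply: le_trans (_ : (`|c| + 1) * `|f a - f b - dot G (a - b)| <= _).
  by rewrite ler_wpM2r// lerDl.
by apply: le_trans (ler_wpM2l (ltW c0) H) _; rewrite mulrA mulrCA divff ?gt_eqF// mulr1.
Qed.

Lemma strict_grad_subl f x p G : strict_grad f (x - p) G ->
  strict_grad (fun z => f (x - z)) p (- G).
Proof.
have E (a b : 'rV[R]_m) : x - a - (x - b) = - (a - b) by apply/rowP => i; rewrite !mxE; ring.
move=> fG e e0; have [d d0 fd] := fG _ e0; exists d => // a b ad bd.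
have := fd (x - a) (x - b); rewrite !E !normrN dotNr dotNl; exact.
Qed.

Lemma strict_grad_continuous f p G : strict_grad f p G -> {for p, continuous f}.
Proof.
by move=> /strict_grad_has_grad/has_grad_grad[/differentiable_continuous].
Qed.

(** If [dot G v] were negative, a short step [t *: v] would change [f] by [t * dot G v] up to an
    error of at most half that size, so [f] would decrease. *)
Lemma has_grad_first_order f x G v : has_grad f x G ->
  (forall t : R, 0 <= t <= 1 -> f x <= f (x + t *: v)) -> 0 <= dot G v.
Proof.
move=> fG fmin; rewrite leNgt; apply/negP => Gv.
have v1 : 0 < `|v| + 1 by rewrite ltr_wpDl.
have [|d d0 fd] := fG (- dot G v / 2 / (`|v| + 1)).
  by rewrite !divr_gt0// oppr_gt0.
pose t := Num.min 1 (d / 2 / (`|v| + 1)).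
have t0 : 0 < t by rewrite lt_min ltr01 !divr_gt0.
have tv : `|t *: v| < d.
  rewrite normrZ gtr0_norm//.
  apply: le_lt_trans (_ : d / 2 / (`|v| + 1) * `|v| < _).
    by rewrite ler_wpM2r// ge_min lexx orbT.
  rewrite mulrAC ltr_pdivrMr//; have : 0 <= d * `|v| by rewrite mulr_ge0// ltW.
  lra.
have := fd _ tv; have := fmin t; rewrite ltW//= ge_min lexx => /(_ isT).
rewrite dotZr ler_norml normrZ gtr0_norm// => fxt /andP[_ ft].
have : - dot G v / 2 / (`|v| + 1) * `|v| <= - dot G v / 2.
  rewrite mulrAC ler_pdivrMr// ler_wpM2l ?lerDl//.
  by rewrite divr_ge0// oppr_ge0 ltW.
move=> /(ler_wpM2l (ltW t0)); have : t * dot G v < 0 by rewrite pmulr_rlt0.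
lra.
Qed.

End Gradients.

(** * Danskin's theorem for suprema over a compact set *)

Section Danskin.
Context {R : realType} {m k : nat}.
Implicit Types (F : 'rV[R]_m -> 'rV[R]_k -> R) (x G : 'rV[R]_m) (y ys : 'rV[R]_k).

(* Joint continuity at (x, y0), and differentiability in the first variable at x with
   gradient G, uniformly in the second variable near y0. *)
Definition joint_grad F x y0 G := forall e : R, 0 < e ->
  exists2 d : R, 0 < d & forall h y, `|h| < d -> `|y - y0| < d ->
    `|F (x + h) y - F x y0| <= e /\ `|F (x + h) y - F x y - dot G h| <= e * `|h|.

Lemma joint_grad_has_grad F x y0 G :
  joint_grad F x y0 G -> has_grad (F^~ y0) x G.
Proof.
move=> FG e e0; have [d d0 Fd] := FG _ e0; exists d => // h hd.
by have [] := Fd h y0 hd; rewrite ?subrr ?normr0.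
Qed.

Lemma joint_gradD F1 F2 x y0 G1 G2 :
  joint_grad F1 x y0 G1 -> joint_grad F2 x y0 G2 ->
  joint_grad (fun a b => F1 a b + F2 a b) x y0 (G1 + G2).
Proof.
move=> FG1 FG2 e e0; have e20 : 0 < e / 2 by rewrite divr_gt0.
have [d1 d10 Fd1] := FG1 _ e20; have [d2 d20 Fd2] := FG2 _ e20.
exists (Num.min d1 d2) => [|h y]; first by rewrite lt_min d10.
rewrite !lt_min => /andP[h1 h2] /andP[y1 y2].
have [+ +] := Fd1 h y h1 y1; have [+ +] := Fd2 h y h2 y2.
by rewrite dotDl !ler_norml; split; lra.
Qed.

Lemma joint_gradZ (c : R) F x y0 G : joint_grad F x y0 G ->
  joint_grad (fun a b => c * F a b) x y0 (c *: G).
Proof.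
move=> FG e e0; have c0 : 0 < `|c| + 1 by rewrite ltr_wpDl.
have [|d d0 Fd] := FG (e / (`|c| + 1)); first exact: divr_gt0.
have cM (a b : R) : `|a| <= e / (`|c| + 1) * b -> `|c * a| <= e * b.
  move=> ab; rewrite normrM; apply: le_trans (_ : (`|c| + 1) * `|a| <= _).
    by rewrite ler_wpM2r// lerDl.
  apply: le_trans (ler_wpM2l (ltW c0) ab) _.
  by rewrite mulrA mulrCA divff ?gt_eqF// mulr1.
exists d => // h y hd yd; have [H1 H2] := Fd h y hd yd.
rewrite dotZl -!mulrBr; split; last exact: cM.
by rewrite -[e]mulr1; apply: cM; rewrite mulr1.
Qed.

Lemma joint_grad_sum (I : finType) (F : I -> 'rV[R]_m -> 'rV[R]_k -> R) x y0
    (G : I -> 'rV[R]_m) : (forall i, joint_grad (F i) x y0 (G i)) ->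
  joint_grad (fun a b => \sum_i F i a b) x y0 (\sum_i G i).
Proof.
move=> FG; elim: (index_enum I) => [|i s IH].
  move=> e e0; exists 1 => // h y _ _.
  by rewrite !big_nil dot0l !subrr normr0; split; [exact: ltW|rewrite mulr_ge0 ?(ltW e0)].
rewrite big_cons.
have -> : (fun a b => \sum_(j <- i :: s) F j a b) = (fun a b => F i a b + \sum_(j <- s) F j a b).
  by apply/funext => a; apply/funext => b; rewrite big_cons.
exact: (joint_gradD (FG i) IH).
Qed.

(** Chain rule for an inner map whose increment [M h] in the first variable is the same for all [y].
    Strict differentiability at [L x y0] covers every base point [L x y] with [y] near [y0]; [G] is
    the adjoint of [M] applied to [g]. *)
Lemma joint_grad_comp (f : 'rV[R]_m -> R) (L : 'rV[R]_m -> 'rV[R]_k -> 'rV[R]_m)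
    (M : 'rV[R]_m -> 'rV[R]_m) x y0 g G :
  strict_grad f (L x y0) g ->
  (forall u v y z (d : R), `|u - v| < d -> `|y - z| < d -> `|L u y - L v z| < 2 * d) ->
  (forall u h y, L (u + h) y - L u y = M h) ->
  (forall h, `|M h| <= `|h|) -> (forall h, dot g (M h) = dot G h) ->
  joint_grad (fun x y => f (L x y)) x y0 G.
Proof.
move=> fg LL LM M1 gM e e0.
have [d1 d10 fd1] := fg _ e0.
have := strict_grad_continuous fg.
move=> /(@cvgrPdist_le _ R^o _ (nbhs (L x y0)) _)/(_ _ e0)/nbhs_ballP[d2 /= d20 fd2].
(* Halved because [L] may move by up to [2 * d]. *)
pose d := Num.min d1 d2 / 2.
have d0 : 0 < d by rewrite divr_gt0// lt_min d10.
exists d => // h y hd yd.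
have dE : 2 * d = Num.min d1 d2 by rewrite /d mulrC divfK.
have xh : `|x + h - x| < d by rewrite addrC addKr.
have := LL _ _ _ _ _ xh yd; rewrite dE lt_min => /andP[Lh1 Lh2]; split.
  by rewrite distrC; apply: fd2; rewrite -ball_normE /= distrC.
have x0 : `|x - x| < d by rewrite subrr normr0.
have := LL _ _ _ _ _ x0 yd; rewrite dE lt_min => /andP[L1 _].
have := fd1 _ _ Lh1 L1; rewrite LM gM => H; apply: le_trans H _.
by rewrite ler_wpM2l// ltW.
Qed.

(* Away from ys the values stay below F x ys by a margin; near ys the uniform
   differentiability applies; compactness makes this uniform over K. *)
Lemma danskin (K : set 'rV[R]_k) F x ys (G : 'rV[R]_k -> 'rV[R]_m) :
  compact K -> K ys ->
  (forall y, K y -> y != ys -> F x y < F x ys) ->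
  (forall y0, K y0 -> joint_grad F x y0 (G y0)) ->
  has_grad (fun x' => sup [set F x' y | y in K]) x (G ys).
Proof.
move=> /compact_near_coveringP Kc Kys Fmax FG e e0.
have : \forall h \near (0 : 'rV[R]_m), K `<=` [set y |
    K y -> F (x + h) y <= F x ys + dot (G ys) h + e * `|h|].
  apply: (Kc _ (nbhs (0 : 'rV[R]_m)) (fun h y =>
    K y -> F (x + h) y <= F x ys + dot (G ys) h + e * `|h|)) => y0 Ky0.
  have [->|y0s] := eqVneq y0 ys.
    have [d d0 Fd] := FG _ Kys _ e0.
    exists (ball ys d, ball (0 : 'rV[R]_m) d) => /=.
      by split; exact: nbhsx_ballx.
    move=> [y h] [] /=; rewrite -!ball_normE /= sub0r normrN distrC => yd hd Ky.
    have [_] := Fd h y hd yd; rewrite ler_norml => /andP[_].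
    have : F x y <= F x ys by have [->//|/(Fmax _ Ky)/ltW] := eqVneq y ys.
    lra.
  (* One half of the gap absorbs the variation of [F] near [(x, y0)], the other half the linear term
     [dot (G ys) h]. *)
  pose eta := (F x ys - F x y0) / 2.
  have eta0 : 0 < eta by rewrite divr_gt0// subr_gt0 Fmax.
  have [d d0 Fd] := FG y0 Ky0 eta eta0.
  have c0 : 0 < m%:R * `|G ys| + 1 by rewrite ltr_wpDl// mulr_ge0.
  exists (ball y0 d, ball (0 : 'rV[R]_m) (Num.min d (eta / (m%:R * `|G ys| + 1)))) => /=.
    by split; apply: nbhsx_ballx => //; rewrite lt_min d0 divr_gt0.
  move=> [y h] [] /=; rewrite -!ball_normE /= sub0r normrN distrC lt_min.
  move=> yd /andP[hd]; rewrite ltr_pdivlMr// => hG Ky.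
  have [+ _] := Fd h y hd yd; rewrite ler_norml => /andP[_].
  have : - eta <= dot (G ys) h.
    have := ler_dot_norm (G ys) h; rewrite ler_norml => /andP[+ _]; apply: le_trans.
    by rewrite lerN2; apply: le_trans _ (ltW hG); rewrite mulrC ler_wpM2l// lerDl.
  have : 0 <= e * `|h| by rewrite mulr_ge0// ltW.
  by rewrite /eta; lra.
move=> /nbhs_ballP[d1 /= d10 Hup]; have [d2 d20 Hlo] := FG _ Kys _ e0.
exists (Num.min d1 d2); first by rewrite lt_min d10.
have up h y : `|h| < d1 -> K y -> F (x + h) y <= F x ys + dot (G ys) h + e * `|h|.
  move=> hd Ky; apply: (Hup h) => //.
  by rewrite -ball_normE /= sub0r normrN.
have Vub h : `|h| < d1 -> sup [set F (x + h) y | y in K] <= F x ys + dot (G ys) h + e * `|h|.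
  move=> hd; apply: ge_sup; first by exists (F (x + h) ys), ys.
  by move=> _ [y Ky <-]; exact: up.
have Vlb h : `|h| < d1 -> F (x + h) ys <= sup [set F (x + h) y | y in K].
  move=> hd; apply: ub_le_sup; last by exists ys.
  by exists (F x ys + dot (G ys) h + e * `|h|) => _ [y Ky <-]; exact: up.
(* At [h = 0] the upper and lower bounds coincide. *)
have -> : sup [set F x y | y in K] = F x ys.
  have h0 : `|0 : 'rV[R]_m| < d1 by rewrite normr0.
  have := Vub 0 h0; have := Vlb 0 h0; rewrite addr0 normr0 mulr0 dotC dot0l !addr0 => ? ?.
  by apply/le_anti/andP.
move=> h; rewrite lt_min => /andP[hd1 hd2].
have [|_] := Hlo h ys hd2; first by rewrite subrr normr0.
have := Vub h hd1; have := Vlb h hd1; rewrite !ler_norml; set s := sup _; lra.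
Qed.

End Danskin.

(** * Block decomposition of profiles inside the full space *)

Section Blocks.
Context {R : realType} {N : nat} {n : 'I_N -> nat}.
Implicit Types (u v w x y : profile R n) (nu : 'I_N).

(* Blocks are handled inside R^n: bmask nu keeps the nu-th block and zeroes the others, which
   avoids the dependent type of submxrow. *)
Definition bmask nu w : profile R n := \row_i (w 0 i *+ (tagnat.sig1 i == nu)).

(** The point [deviate x (submxrow y nu)], written without dependent types. *)
Definition mix nu x y : profile R n := x + bmask nu (y - x).

Lemma bmaskD nu u v : bmask nu (u + v) = bmask nu u + bmask nu v.
Proof. by apply/rowP => i; rewrite !mxE mulrnDl. Qed.

Lemma bmaskZ nu (a : R) u : bmask nu (a *: u) = a *: bmask nu u.
Proof. by apply/rowP => i; rewrite !mxE mulrnAr. Qed.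

Lemma bmaskB nu u v : bmask nu (u - v) = bmask nu u - bmask nu v.
Proof. by apply/rowP => i; rewrite !mxE mulrnBl. Qed.

Lemma bmask_id nu u : bmask nu (bmask nu u) = bmask nu u.
Proof. by apply/rowP => i; rewrite !mxE; case: eqP. Qed.

Lemma dot_bmask nu u v : dot (bmask nu u) v = dot u (bmask nu v).
Proof. by apply: eq_bigr => i _; rewrite !mxE mulrnAl mulrnAr. Qed.

Lemma dot_bmaskC nu u v : dot (u - bmask nu u) (bmask nu v) = 0.
Proof. by rewrite -dot_bmask bmaskB bmask_id subrr dot0l. Qed.

Lemma enorm_bmask_sqr nu u : enorm (bmask nu u) ^+ 2 = dot (bmask nu u) u.
Proof. by rewrite enorm_sqr dot_bmask bmask_id dotC. Qed.

Lemma sum_bmask u : \sum_nu bmask nu u = u.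
Proof.
apply/rowP => i; rewrite summxE (bigD1 (tagnat.sig1 i))//= [X in _ + X]big1 ?addr0.
  by rewrite mxE eqxx.
by move=> mu; rewrite eq_sym mxE => /negbTE ->.
Qed.

Lemma sum_bmask_mxrow (g : 'I_N -> profile R n) :
  \sum_nu bmask nu (g nu) = \mxrow_nu submxrow (g nu) nu.
Proof.
apply/rowP => i; rewrite summxE (bigD1 (tagnat.sig1 i))//= [X in _ + X]big1 ?addr0.
  by rewrite !mxE eqxx tagnat.sig2K.
by move=> mu; rewrite eq_sym mxE => /negbTE ->.
Qed.

Lemma mx_norm_bmask nu u : `|bmask nu u| <= `|u|.
Proof.
apply: ler_mx_norm => // i; rewrite mxE.
by case: eqP => _; rewrite ?mulr1n ?mulr0n ?normr0// ler_coord.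
Qed.

(** Pythagoras: the two summands have disjoint supports. *)
Lemma enorm_bmaskC nu u v : enorm (u - bmask nu u + bmask nu v) ^+ 2 =
  enorm (u - bmask nu u) ^+ 2 + enorm (bmask nu v) ^+ 2.
Proof.
have := dot_bmaskC nu u v; move: (u - bmask nu u) (bmask nu v) => a b ab.
by rewrite !enorm_sqr dotDl !dotDr (dotC b a) ab addr0 add0r.
Qed.

Lemma ler_enorm_bmask nu u : enorm (bmask nu u) <= enorm u.
Proof.
rewrite -(ler_pXn2r (n := 2)) ?nnegrE ?enorm_ge0//.
have := enorm_bmaskC nu u u; rewrite subrK => ->.
by rewrite lerDr sqr_ge0.
Qed.

Lemma ler_enorm_subr_bmask nu u : enorm (u - bmask nu u) <= enorm u.
Proof.
rewrite -(ler_pXn2r (n := 2)) ?nnegrE ?enorm_ge0//.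
have := enorm_bmaskC nu u u; rewrite subrK => ->.
by rewrite lerDl sqr_ge0.
Qed.

(** Reindexing the coordinates by pairs of a block and a position, only the pairs of block [nu]
    contribute. *)
Lemma enorm_submxrow nu u : enorm (submxrow u nu) = enorm (bmask nu u).
Proof.
rewrite /enorm; congr Num.sqrt.
transitivity (\sum_mu \sum_(k < n mu) bmask nu u 0 (tagnat.Rank mu k) ^+ 2).
  rewrite (bigD1 nu)//= [X in _ = _ + X]big1 ?addr0 => [|mu munu].
    by apply: eq_bigr => k _; rewrite !mxE tagnat.Rank1K eqxx.
  by rewrite big1// => k _; rewrite !mxE tagnat.Rank1K (negbTE munu) mulr0n expr0n.
rewrite sig_big_dep /= [RHS](reindex (@tagnat.rank N n)) /=; last exact: tagnat.rank_bij_on.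
by apply: eq_bigr => -[mu k].
Qed.

Lemma deviate_submxrow nu x y : deviate x (submxrow y nu) = mix nu x y.
Proof.
apply/rowP => i; rewrite !mxE.
have [e|ne] := eqVneq (tagnat.sig1 i) nu.
  rewrite mulr1n addrC subrK.
  (* Coordinate [i] is written as a rank and [tagnat.sig2 i] is generalized, so that its dependent
     type can follow the equation [e]. *)
  rewrite -[in RHS](tagnat.sig2K i); move: (tagnat.sig2 i); rewrite e => k.
  by rewrite dfwith_in !mxE.
by rewrite mulr0n addr0 dfwith_out 1?eq_sym// mxE tagnat.sig2K.
Qed.

Lemma submxrow_bmask nu u : submxrow (bmask nu u) nu = submxrow u nu.
Proof. by apply/rowP => k; rewrite !mxE tagnat.Rank1K eqxx. Qed.

Lemma submxrow_mix nu x y : submxrow (mix nu x y) nu = submxrow y nu.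
Proof. by rewrite submxrowD submxrow_bmask submxrowB addrC subrK. Qed.

Lemma submxrow_mix_neq mu nu x y : mu != nu ->
  submxrow (mix nu x y) mu = submxrow x mu.
Proof.
by move=> ne; apply/rowP => k; rewrite !mxE tagnat.Rank1K (negbTE ne) mulr0n addr0.
Qed.

Lemma submxrow_ybest theta (X : forall nu, set 'rV[R]_(n nu)) alpha x nu :
  submxrow (ybest theta X alpha x) nu = yblock theta X alpha nu x.
Proof. exact: mxrowK. Qed.

(** The two orthogonal parts have the shape that [enorm_bmaskC] expects. *)
Lemma mixB nu u v y z : mix nu u y - mix nu v z =
  (u - v) - bmask nu (u - v) + bmask nu (y - z).
Proof. by apply/rowP => i; rewrite !mxE; case: eqP => _; rewrite ?mulr1n ?mulr0n; ring. Qed.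

(** Each coordinate of the difference is one of [u - v] or of [y - z]. *)
Lemma mx_norm_mix nu u v y z (d : R) : `|u - v| < d -> `|y - z| < d ->
  `|mix nu u y - mix nu v z| < d.
Proof.
move=> uv yz; apply: le_lt_trans (_ : Num.max `|u - v| `|y - z| < d); last first.
  by rewrite gt_max uv.
apply: ler_mx_norm => [|i]; first by rewrite le_max normr_ge0.
rewrite mixB le_max !mxE; have := ler_coord (u - v) i; have := ler_coord (y - z) i.
rewrite !mxE; case: eqP => _; rewrite ?mulr1n ?mulr0n.
  by rewrite subrr add0r => ->; rewrite orbT.
by rewrite subr0 addr0 => _ ->.
Qed.

(** * Compactness, convexity and diameters of the strategy sets *)

Section Strategies.
Context (X : forall nu, set 'rV[R]_(n nu)).
Arguments X : clear implicits.
Context (X_compact : forall nu, compact (X nu)).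
Context (X_convex : forall nu, convex_set (X nu)).

Lemma profiles_mix nu x y :
  profiles X x -> X nu (submxrow y nu) -> profiles X (mix nu x y).
Proof.
move=> Xx Xy mu; have [->|ne] := eqVneq mu nu; first by rewrite submxrow_mix.
by rewrite submxrow_mix_neq.
Qed.

Lemma profiles_convex x y (t : R) : 0 <= t <= 1 ->
  profiles X x -> profiles X y -> profiles X (x + t *: (y - x)).
Proof.
move=> /andP[t0 t1] Xx Xy nu.
pose s := Itv01 t0 t1.
have := @X_convex nu _ _ s (mem_set (Xy nu)) (mem_set (Xx nu)).
move=> /set_mem; congr (X nu _).
by apply/rowP => k; rewrite !mxE /= /unstable.onem; ring.
Qed.

Lemma submxrow_continuous nu : continuous (fun x : profile R n => submxrow x nu).
Proof.
move=> x; apply/(@cvgrPdist_lt _ 'rV[R]_(n nu) _ (nbhs x) _) => e e0.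
apply/nbhs_ballP; exists e => //= y; rewrite -ball_normE /= -submxrowB.
apply: le_lt_trans; apply: ler_mx_norm => // k; rewrite mxE; exact: ler_coord.
Qed.

(** Closed as an intersection of preimages under the continuous block maps, and bounded by the sum
    of bounds on the blocks. *)
Lemma profiles_compact : compact (profiles X).
Proof.
apply: bounded_closed_compact; last first.
  have -> : profiles X = \bigcap_nu [set x | X nu (submxrow x nu)].
    by apply/seteqP; split => x Xx nu; [move=> _|]; exact: Xx.
  apply: closed_bigI => nu _; apply: closed_comp; last first.
    by apply: compact_closed => //; exact: norm_hausdorff.
  by move=> x _; exact: submxrow_continuous.
have bX nu : exists2 M : R, 0 <= M & forall z, X nu z -> `|z| <= M.
  have [M [Mr XM]] := compact_bounded (@X_compact nu).
  exists (`|M| + 1); first by rewrite addr_ge0.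
  by move=> z Xz; apply: (XM (`|M| + 1)) => //; rewrite ltr_pwDr// real_ler_norm.
have [M HM] := choice (fun nu => let: ex_intro2 M M0 XM := bX nu in
  ex_intro (fun M => 0 <= M /\ forall z, X nu z -> `|z| <= M) M (conj M0 XM)).
exists (\sum_nu M nu); split => [|B /ltW sB x Xx]; first exact: num_real.
apply: le_trans _ sB; apply: ler_mx_norm => [|i].
  by apply: sumr_ge0 => nu _; case: (HM nu).
rewrite [leRHS](bigD1 (tagnat.sig1 i))//=; apply: le_trans (_ : M (tagnat.sig1 i) <= _); last first.
  by rewrite lerDl; apply: sumr_ge0 => nu _; case: (HM nu).
have [_ /(_ _ (Xx (tagnat.sig1 i)))] := HM (tagnat.sig1 i); apply: le_trans.
by have := ler_coord (submxrow x (tagnat.sig1 i)) (tagnat.sig2 i); rewrite mxE tagnat.sig2K.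
Qed.

(** Compactness bounds the set of distances, so that its [sup] is a genuine upper bound. *)
Lemma ler_ediam nu (z w : 'rV[R]_(n nu)) : X nu z -> X nu w ->
  enorm (z - w) <= ediam (X nu).
Proof.
move=> Xz Xw; apply: ub_le_sup; last by exists (z, w).
have [M [Mr XM]] := compact_bounded (@X_compact nu).
have bM z' : X nu z' -> `|z'| <= `|M| + 1.
  by move=> Xz'; apply: (XM (`|M| + 1)) => //; rewrite ltr_pwDr// real_ler_norm.
exists (((n nu)%:R + 1) * ((`|M| + 1) + (`|M| + 1))) => _ [[a b] [/= Xa Xb] <-].
apply: le_trans (ler_enorm_norm _) _; rewrite ler_wpM2l ?addr_ge0//.
by apply: le_trans (ler_normB _ _) _; rewrite lerD ?bM.
Qed.

End Strategies.
End Blocks.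

(** * Penalized costs, best responses and their variational inequality *)

Section Game.
Context {R : realType} {N : nat} {n : 'I_N -> nat}.
Context (X : forall nu, set 'rV[R]_(n nu)).
Arguments X : clear implicits.
Context (theta : 'I_N -> profile R n -> R).
Context (L0 L1 : 'I_N -> R) (alpha : R).
Context (X_compact : forall nu, compact (X nu)).
Context (X_convex : forall nu, convex_set (X nu)).
Context (theta_convex : forall nu, player_convex X nu (theta nu)).
Context (theta_lipschitz : forall nu, elipschitz_fun (L0 nu) (profiles X) (theta nu)).
Context (theta_smooth : forall nu, smooth_on (L1 nu) (profiles X) (theta nu)).
Context (alpha_gt0 : 0 < alpha).
Implicit Types (x y u v w : profile R n) (nu : 'I_N).

Local Notation XX := (profiles X).
Local Notation ya := (ybest theta X alpha).
Local Notation g nu := (grad (theta nu)).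

(** On block [nu], [|a|^2 - |b|^2 - 2 p.(a - b) = ((a - p) + (b - p)).(a - b)], whose first factor
    is small near [p]. *)
Lemma strict_grad_sqr_bmask nu p :
  strict_grad (fun w => enorm (bmask nu w) ^+ 2) p (2 *: bmask nu p).
Proof.
move=> e e0; set m := (\sum_(nu < N) n nu)%N.
have c0 : 0 < m%:R * 2 + 1 :> R by rewrite ltr_wpDl// mulr_ge0.
exists (e / (m%:R * 2 + 1)) => [|a b ad bd]; first exact: divr_gt0.
have -> : enorm (bmask nu a) ^+ 2 - enorm (bmask nu b) ^+ 2 - dot (2 *: bmask nu p) (a - b) =
    dot (bmask nu ((a - p) + (b - p))) (a - b).
  have ab : dot (bmask nu a) b = dot (bmask nu b) a by rewrite dot_bmask dotC.
  rewrite !enorm_bmask_sqr dotZl bmaskD !bmaskB dotDl !dotBl !dotBr ab; ring.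
apply: le_trans (ler_dot_norm _ _) _; rewrite ler_wpM2r//.
apply: le_trans (_ : m%:R * (2 * (e / (m%:R * 2 + 1))) <= _).
  rewrite ler_wpM2l//; apply: le_trans (mx_norm_bmask _ _) _.
  by apply: le_trans (ler_normD _ _) _; rewrite mulr_natl mulr2n lerD// ltW.
by rewrite !mulrA ler_pdivrMr// mulrC ler_wpM2l ?(ltW e0)// lerDl.
Qed.

Lemma theta_strict_grad nu p : XX p -> strict_grad (theta nu) p (g nu p).
Proof.
case: (theta_smooth nu) => -[U [oU XU dU cU]] _ Xp.
by apply: (C1_strict_grad oU) => //; [exact: XU|apply: cU; exact: XU].
Qed.

(** The objective [regularized] as a function of a full profile [p], so that all calculus takes
    place in one space. *)
Definition penalized nu x p : R := theta nu p + alpha / 2 * enorm (bmask nu (x - p)) ^+ 2.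

Lemma regularizedE nu x y :
  regularized theta alpha x (submxrow y nu) = penalized nu x (mix nu x y).
Proof.
rewrite /regularized /penalized deviate_submxrow -submxrowB enorm_submxrow.
by congr (_ + _ * enorm _ ^+ 2); apply/rowP => i; rewrite !mxE;
  case: eqP => _; rewrite ?mulr1n ?mulr0n//; ring.
Qed.

Lemma penalized_strict_grad nu x p : XX p ->
  strict_grad (penalized nu x) p (g nu p + alpha *: bmask nu (p - x)).
Proof.
move=> Xp; have -> : alpha *: bmask nu (p - x) = (alpha / 2) *: - (2 *: bmask nu (x - p)).
  by apply/rowP => i; rewrite !mxE; case: eqP => _; rewrite ?mulr1n ?mulr0n; field.
exact: (strict_gradD (theta_strict_grad nu Xp)
  (strict_gradZ _ (strict_grad_subl (strict_grad_sqr_bmask nu (x - p))))).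
Qed.

Lemma mix_continuous nu x : continuous (mix nu x).
Proof.
move=> y; apply/(@cvgrPdist_lt _ (profile R n) _ (nbhs y) _) => e e0.
apply/nbhs_ballP; exists e => //= z; rewrite -ball_normE /= => yz.
by apply: mx_norm_mix => //; rewrite subrr normr0.
Qed.

(** The extreme value theorem is applied on the compact set of profiles: [mix nu x y] depends on [y]
    only through block [nu], and every strategy [w] is such a block. *)
Lemma yblockP nu x : XX x -> X nu (yblock theta X alpha nu x) /\
  forall w : 'rV[R]_(n nu), X nu w -> regularized theta alpha x (yblock theta X alpha nu x) <=
    regularized theta alpha x w.
Proof.
move=> Xx; suff exP : exists z : 'rV[R]_(n nu), X nu z /\
  forall w : 'rV[R]_(n nu), X nu w ->
  regularized theta alpha x z <= regularized theta alpha x w by exact: (xgetPex 0 exP).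
have [||y /set_mem Xy ymin] := @compact_EVT_min _ _ (penalized nu x \o mix nu x) XX _
    (profiles_compact X_compact).
- by exists x.
- apply: continuous_in_subspaceT => y /set_mem Xy.
  apply: (@continuous_comp _ _ R^o); first exact: mix_continuous.
  apply: strict_grad_continuous (penalized_strict_grad _ _ _).
  by apply: profiles_mix => //; exact: Xy.
exists (submxrow y nu); split => // w Xw.
pose z := deviate x w.
have zw : submxrow z nu = w by rewrite /z /deviate mxrowK dfwith_in.
have Xz : XX z.
  move=> mu; rewrite /z /deviate mxrowK; have [->|ne] := eqVneq mu nu; first by rewrite dfwith_in.
  by rewrite dfwith_out 1?eq_sym.
by rewrite -zw !regularizedE; apply: ymin; exact: mem_set.
Qed.

Lemma ybest_profiles x : XX x -> XX (ya x).
Proof. by move=> Xx nu; rewrite submxrow_ybest; case: (yblockP nu Xx). Qed.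

Lemma ybest_min nu x w : XX x -> XX w ->
  penalized nu x (mix nu x (ya x)) <= penalized nu x (mix nu x w).
Proof.
by move=> Xx Xw; rewrite -!regularizedE submxrow_ybest; case: (yblockP nu Xx) => _; apply.
Qed.

Lemma mix_line nu x y w (t : R) :
  mix nu x (y + t *: (w - y)) = mix nu x y + t *: bmask nu (w - y).
Proof. by apply/rowP => i; rewrite !mxE; case: eqP => _; rewrite ?mulr1n ?mulr0n; ring. Qed.

(** First-order condition along the segment from [ya x] to [w], which convexity keeps feasible. *)
Lemma ybest_variational nu x w : XX x -> XX w ->
  0 <= dot (bmask nu (g nu (mix nu x (ya x)) + alpha *: (ya x - x))) (w - ya x).
Proof.
move=> Xx Xw; have Xy := ybest_profiles Xx.
have Xm : XX (mix nu x (ya x)) by exact: profiles_mix.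
have -> : dot (bmask nu (g nu (mix nu x (ya x)) + alpha *: (ya x - x))) (w - ya x) =
    dot (g nu (mix nu x (ya x)) + alpha *: bmask nu (mix nu x (ya x) - x)) (bmask nu (w - ya x)).
  have -> : mix nu x (ya x) - x = bmask nu (ya x - x) by rewrite /mix addrC addKr.
  by rewrite bmask_id dot_bmask !dotDl; congr (_ + _); rewrite -bmaskZ dot_bmask bmask_id.
apply: has_grad_first_order (strict_grad_has_grad (penalized_strict_grad nu x Xm)) _ => t t01.
by rewrite -mix_line; apply: ybest_min => //; exact: profiles_convex.
Qed.

(* The quadratic penalty makes the value at a midpoint strictly smaller. *)
Lemma penalized_min_unique nu x y w : XX x -> XX y -> XX w ->
  (forall z, XX z -> penalized nu x (mix nu x y) <= penalized nu x (mix nu x z)) ->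
  penalized nu x (mix nu x w) <= penalized nu x (mix nu x y) ->
  bmask nu (w - y) = 0.
Proof.
move=> Xx Xy Xw ymin wmin.
have h0 : (0 : R) <= 2^-1 by rewrite invr_ge0.
have h1 : (2^-1 : R) <= 1 by rewrite invf_le1 ?ler1n.
have hB : 0 <= (2^-1 : R) <= 1 by rewrite h0.
pose z := y + 2^-1 *: (w - y).
have Xz : XX z by exact: profiles_convex.
have := ymin z Xz.
have := @theta_convex nu x (fun mu _ => Xx mu) (Itv01 h0 h1) _ _
  (mem_set (Xw nu)) (mem_set (Xy nu)).
rewrite convRE /= !deviate_submxrow /unstable.onem.
have -> : deviate x (2^-1 *: submxrow w nu + (1 - 2^-1) *: submxrow (y) nu) = mix nu x z.
  rewrite -deviate_submxrow; congr deviate.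
  by apply/rowP => k; rewrite !mxE; field.
have mE y' : enorm (bmask nu (x - mix nu x y')) ^+ 2 = dot (bmask nu (x - y')) (bmask nu (x - y')).
  rewrite enorm_sqr /mix opprD addNKr -[- _]scaleN1r bmaskZ bmask_id -bmaskZ.
  by rewrite scaleN1r opprB.
move=> tz; move: wmin; rewrite /penalized (mE w) (mE y) (mE z) => wmin pz.
have := dot_ge0 (bmask nu (w - y)).
rewrite le_eqVlt => /orP[/eqP/esym/dot_eq0//|].
have zE : bmask nu (x - z) = 2^-1 *: (bmask nu (x - w) + bmask nu (x - y)).
  by apply/rowP => i; rewrite !mxE; case: eqP => _; rewrite ?mulr1n ?mulr0n; field.
have wE : bmask nu (w - y) = bmask nu (x - y) - bmask nu (x - w).
  by apply/rowP => i; rewrite !mxE; case: eqP => _; rewrite ?mulr1n ?mulr0n; ring.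
move: wmin pz; rewrite zE wE; set a := bmask nu (x - w); set b := bmask nu (x - y).
rewrite !(dotZl, dotZr, dotBl, dotBr, dotDl, dotDr) (dotC b a) => wmin pz pos.
(* By the parallelogram identity the midpoint value is below the minimum by at least
   [alpha / 8 * |a - b|^2]. *)
have : 0 < alpha * (dot b b - dot a b - (dot a b - dot a a)) by rewrite mulr_gt0.
by move=> ?; exfalso; lra.
Qed.

Lemma ybest_unique nu x w : XX x -> XX w ->
  penalized nu x (mix nu x w) <= penalized nu x (mix nu x (ya x)) ->
  bmask nu (w - ya x) = 0.
Proof.
move=> Xx Xw; apply: (penalized_min_unique Xx (ybest_profiles Xx) Xw) => z.
exact: ybest_min.
Qed.

(** * The unique maximizer of [Psi] and the gradients of [Psi] and [V] *)

Lemma eq_sum_le (I : finType) (F G : I -> R) : (forall i, F i <= G i) ->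
  \sum_i F i = \sum_i G i -> forall i, F i = G i.
Proof.
move=> FG eqFG i; apply/esym/eqP; rewrite -subr_eq0.
have : \sum_j (G j - F j) == 0 by rewrite sumrB eqFG subrr.
rewrite psumr_eq0 => [/allP/(_ i)|j _]; last by rewrite subr_ge0.
by rewrite mem_index_enum; apply.
Qed.

Lemma PsiE x y : Psi theta alpha x y =
  \sum_nu (theta nu x - penalized nu x (mix nu x y)).
Proof.
apply: eq_bigr => nu _; rewrite -regularizedE /regularized; ring.
Qed.

(** Each player's term is maximized by [ya x]. Equal totals force equality for every player, and
    uniqueness then kills every block of [y - ya x]. *)
Lemma Psi_max x y : XX x -> XX y -> y != ya x ->
  Psi theta alpha x y < Psi theta alpha x (ya x).
Proof.
move=> Xx Xy ny; rewrite !PsiE.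
have le nu : theta nu x - penalized nu x (mix nu x y) <=
    theta nu x - penalized nu x (mix nu x (ya x)).
  by rewrite lerD2l lerN2; exact: ybest_min.
rewrite lt_neqAle ler_sum ?andbT//; apply: contra_neq ny => /(eq_sum_le le) eqPsi.
apply/subr0_eq; rewrite -(sum_bmask (y - ya x)); apply: big1 => nu _.
apply: (ybest_unique Xx Xy); move: (eqPsi nu); rewrite le_eqVlt => /addrI/oppr_inj ->.
by rewrite eqxx.
Qed.

(** The shape delivered by the sum and chain rules. Block [nu] of the gradient at [mix nu x y] is
    removed, since that block comes from [y] and does not move with [x]. *)
Definition gradPsi x y : profile R n :=
  \sum_nu (g nu x + (-1) *: (g nu (mix nu x y) - bmask nu (g nu (mix nu x y)))
    + (- (alpha / 2)) *: (2 *: bmask nu (x - y))).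

(** Each player contributes compositions with [x], [mix nu x y] and [x - y], whose increments in [x]
    are [h], [h - bmask nu h] and [h]. *)
Lemma Psi_joint_grad x y : XX x -> XX y ->
  joint_grad (Psi theta alpha) x y (gradPsi x y).
Proof.
move=> Xx Xy.
have -> : Psi theta alpha = fun x y => \sum_nu (theta nu x + (-1) * theta nu (mix nu x y)
    + (- (alpha / 2)) * enorm (bmask nu (x - y)) ^+ 2).
  apply/funext => a; apply/funext => b; apply: eq_bigr => nu _.
  by rewrite deviate_submxrow -submxrowB enorm_submxrow mulN1r mulNr.
have twice (a b d : R) : `|a| < d -> a < d -> a < 2 * d.
  by move=> ad; have := le_lt_trans (normr_ge0 _) ad; lra.
apply: joint_grad_sum => nu; apply: joint_gradD; first apply: joint_gradD.
- apply: (joint_grad_comp (L := fun x _ => x) (M := id) (theta_strict_grad nu Xx)) => //.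
    by move=> u v _ _ d ud _; have := le_lt_trans (normr_ge0 _) ud; lra.
  by move=> u h _; rewrite addrC addKr.
- apply: joint_gradZ.
  apply: (joint_grad_comp (M := fun h => h - bmask nu h)
    (theta_strict_grad nu (profiles_mix Xx (Xy nu)))).
  + move=> u v a b d ud ad; have := mx_norm_mix nu ud ad.
    by have := le_lt_trans (normr_ge0 _) ud; lra.
  + by move=> u h b; apply/rowP => i; rewrite !mxE; case: eqP => _; rewrite ?mulr1n ?mulr0n; ring.
  + move=> h; apply: ler_mx_norm => // i; rewrite !mxE.
    by case: eqP => _; rewrite ?subrr ?subr0 ?normr0// ler_coord.
  + by move=> h; rewrite dotBr -dot_bmask -dotBl.
- apply: joint_gradZ.
  apply: (joint_grad_comp (L := fun x y => x - y) (M := id)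
    (strict_grad_sqr_bmask nu (x - y))) => //.
  + move=> u v a b d ud ad.
    have -> : u - a - (v - b) = (u - v) - (a - b) by apply/rowP => i; rewrite !mxE; ring.
    by apply: le_lt_trans (ler_normB _ _) _; lra.
  + by move=> u h b; apply/rowP => i; rewrite !mxE; ring.
Qed.

Lemma gradPsiE x y : gradPsi x y =
  \sum_nu (g nu x - g nu (mix nu x y)) + \sum_nu bmask nu (g nu (mix nu x y))
  - alpha *: (x - y).
Proof.
rewrite -[in RHS](sum_bmask (x - y)) scaler_sumr -big_split -sumrB /=; apply: eq_bigr => nu _.
by rewrite scaleN1r scalerA mulNr divfK// scaleNr opprD opprK addrA.
Qed.

Lemma V_has_grad x : XX x -> has_grad (V theta X alpha) x (gradPsi x (ya x)).
Proof.
move=> Xx; apply: (danskin (F := Psi theta alpha) (G := gradPsi x)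
  (profiles_compact X_compact) (ybest_profiles Xx)).
  by move=> y Xy; exact: Psi_max.
by move=> y Xy; exact: Psi_joint_grad.
Qed.

Lemma Psi_le x y : XX x -> XX y -> Psi theta alpha x y <= Psi theta alpha x (ya x).
Proof.
by move=> Xx Xy; have [->//|ny] := eqVneq y (ya x); exact/ltW/Psi_max.
Qed.

Lemma V_ybest x : XX x -> V theta X alpha x = Psi theta alpha x (ya x).
Proof.
move=> Xx; have Xy := ybest_profiles Xx; apply/le_anti/andP; split.
  by apply: ge_sup => [|_ [y Yy <-]]; [exists (Psi theta alpha x (ya x)), (ya x)|exact: Psi_le].
apply: ub_le_sup; last by exists (ya x).
by exists (Psi theta alpha x (ya x)) => _ [y Yy <-]; exact: Psi_le.
Qed.

(** * Lipschitz estimates for the best responses, for [V] and for its gradient *)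

Lemma lipschitz_const_ge0 (L r : R) u v : u != v -> 0 <= r ->
  r <= L * enorm (u - v) -> 0 <= L.
Proof.
move=> uv r0 rL; have D0 : 0 < enorm (u - v).
  rewrite lt_neqAle enorm_ge0 andbT eq_sym; apply: contra_neq uv => /enorm_eq0.
  exact: subr0_eq.
by rewrite -(pmulr_lge0 _ D0); exact: le_trans rL.
Qed.

(** The variational inequality at [u] is tested with [ya v], the one at [v] with [ya u], and the two
    are added. *)
Lemma ybest_monotone nu u v : XX u -> XX v ->
  0 <= dot (bmask nu (alpha *: ((u - v) - (ya u - ya v)) -
    (g nu (mix nu u (ya u)) - g nu (mix nu v (ya v))))) (ya u - ya v).
Proof.
move=> Xu Xv.
have := ybest_variational nu Xu (ybest_profiles Xv).
have := ybest_variational nu Xv (ybest_profiles Xu).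
set gv := g nu (mix nu v _); set gu := g nu (mix nu u _).
rewrite -(opprB (ya u) (ya v)) dotNr oppr_ge0 => H1 H2.
move: gu gv H1 H2 => gu gv H1 H2.
have -> : alpha *: (u - v - (ya u - ya v)) - (gu - gv) =
    (gv + alpha *: (ya v - v)) - (gu + alpha *: (ya u - u)).
  by apply/rowP => i; rewrite !mxE; ring.
by rewrite bmaskB dotBl subr_ge0; exact: le_trans H2 H1.
Qed.

(** For the changes [a] of the profile, [b] of the best response and [c] of the gradient block,
    monotonicity gives [alpha |b|^2 <= alpha |a| |b| + |c| |b|], where [|c| <= LG (|a| + |b|)].
    Dividing by [|b|] leaves [(alpha - LG) |b| <= (alpha + LG) |a|]. *)
Lemma yblock_lipschitz nu (LG : R) :
  elipschitz LG XX (fun x => submxrow (g nu x) nu) -> LG < alpha ->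
  elipschitz ((alpha + LG) / (alpha - LG)) XX (yblock theta X alpha nu).
Proof.
move=> gL La u v Xu Xv.
have [->|uv] := eqVneq u v; first by rewrite !subrr !enorm0 mulr0.
have LG0 : 0 <= LG by apply: lipschitz_const_ge0 uv (enorm_ge0 _) (gL u v Xu Xv).
have aL : 0 < alpha - LG by rewrite subr_gt0.
rewrite -!submxrow_ybest -submxrowB enorm_submxrow.
have := ybest_monotone nu Xu Xv; rewrite -[bmask nu _]bmask_id dot_bmask.
set p := mix nu u _; set q := mix nu v _.
set a := u - v; set b := bmask nu (ya u - ya v).
rewrite bmaskB bmaskZ bmaskB -/b dotBl dotZl dotBl -enorm_sqr.
set c := bmask nu (g nu p - g nu q) => H.
have pq : enorm (p - q) <= enorm a + enorm b.
  rewrite mixB; apply: le_trans (ler_enormD _ _) _.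
  by rewrite lerD2r ler_enorm_subr_bmask.
have cL : enorm c <= LG * (enorm a + enorm b).
  rewrite /c -enorm_submxrow submxrowB; apply: le_trans (gL p q _ _) _.
  - by apply: profiles_mix => //; exact: ybest_profiles.
  - by apply: profiles_mix => //; exact: ybest_profiles.
  - exact: ler_wpM2l.
have ab := le_trans (ler_dot (bmask nu a) b)
  (ler_wpM2r (enorm_ge0 b) (ler_enorm_bmask nu a)).
have cb : - dot c b <= LG * (enorm a + enorm b) * enorm b.
  rewrite -dotNl; apply: le_trans (ler_dot _ _) _.
  by rewrite enormN ler_wpM2r// enorm_ge0.
have D0 := enorm_ge0 a.
rewrite mulrAC ler_pdivlMr//.
have [->|b0] := eqVneq (enorm b) 0; first by rewrite mul0r mulr_ge0// addr_ge0// ltW.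
have {}b0 : 0 < enorm b by rewrite lt_def b0 enorm_ge0.
rewrite -(ler_pM2r b0).
have := ler_wpM2l (ltW alpha_gt0) ab; lra.
Qed.

(** Pythagoras: the change is at most [|u - v|] off block [nu] and at most [Ly |u - v|] on it. *)
Lemma enorm_mixB nu (Ly : R) u v : elipschitz Ly XX (yblock theta X alpha nu) ->
  XX u -> XX v ->
  enorm (mix nu u (ya u) - mix nu v (ya v)) <= Num.sqrt (1 + Ly ^+ 2) * enorm (u - v).
Proof.
move=> yL Xu Xv; have := yL u v Xu Xv.
rewrite -!submxrow_ybest -submxrowB enorm_submxrow mixB.
set a := u - v => bL.
rewrite -(ler_pXn2r (n := 2)) ?nnegrE ?mulr_ge0 ?enorm_ge0 ?sqrtr_ge0//.
rewrite enorm_bmaskC exprMn (@sqr_sqrtr _ (1 + Ly ^+ 2)); last by rewrite addr_ge0 ?sqr_ge0.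
rewrite mulrDl mul1r -exprMn.
apply: lerD; rewrite ler_pXn2r ?nnegrE ?enorm_ge0 ?ler_enorm_subr_bmask//.
exact: le_trans (enorm_ge0 _) bL.
Qed.

(** Each of the two cost terms contributes [L0]. The penalty contributes [alpha / 2] times a
    difference of squares, itself at most [2 C |u - v|] for the diameter [C]. *)
Lemma Psi_lipschitz x u v : XX u -> XX v -> XX x ->
  Psi theta alpha u x - Psi theta alpha v x <=
  (\sum_nu (L0 nu * 2 + alpha * ediam (X nu))) * enorm (u - v).
Proof.
move=> Xu Xv Xx; rewrite -sumrB mulr_suml; apply: ler_sum => nu _.
rewrite !deviate_submxrow.
have L1' := le_trans (ler_norm _) (theta_lipschitz nu Xu Xv).
have := theta_lipschitz nu (profiles_mix Xv (Xx nu)) (profiles_mix Xu (Xx nu)).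
move/(le_trans (ler_norm _)).
have [->|uv] := eqVneq u v; first by rewrite !subrr enorm0 !mulr0 => _.
have L0ge0 : 0 <= L0 nu := lipschitz_const_ge0 uv (normr_ge0 _) (theta_lipschitz nu Xu Xv).
have : enorm (mix nu v x - mix nu u x) <= enorm (u - v).
  rewrite enormBC mixB subrr.
  have -> : bmask nu 0 = 0 :> profile R n by rewrite -(scale0r 0) bmaskZ !scale0r.
  by rewrite addr0 ler_enorm_subr_bmask.
move=> /(ler_wpM2l L0ge0) /[swap] /le_trans /[apply] L2'.
have := ler_ediam X_compact (Xu nu) (Xx nu); have := ler_ediam X_compact (Xv nu) (Xx nu).
set b := submxrow v nu - _; set a := submxrow u nu - _ => bC aC.
have ba : enorm b <= enorm a + enorm (u - v).
  have -> : b = a - (submxrow u nu - submxrow v nu).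
    by rewrite /a /b; apply/rowP => i; rewrite !mxE; ring.
  apply: le_trans (ler_enormB _ _) _.
  by rewrite lerD2l -submxrowB enorm_submxrow ler_enorm_bmask.
have ab : enorm b ^+ 2 - enorm a ^+ 2 <= 2 * ediam (X nu) * enorm (u - v).
  have a0 := enorm_ge0 a; have b0 := enorm_ge0 b; have d0 := enorm_ge0 (u - v).
  have : 0 <= (enorm a + enorm (u - v) - enorm b) * (enorm a + enorm b).
    by apply: mulr_ge0; [rewrite subr_ge0|exact: addr_ge0].
  have : 0 <= (2 * ediam (X nu) - enorm a - enorm b) * enorm (u - v).
    by rewrite mulr_ge0//; lra.
  lra.
have := ler_wpM2l (ltW alpha_gt0) ab; lra.
Qed.

(** The maximizer at [u] competes at [v], so [V] grows from [v] to [u] by at most the change of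
    [Psi] with second argument [ya u]; symmetrically with [ya v]. *)
Lemma V_lipschitz :
  elipschitz_fun (\sum_nu (L0 nu * 2 + alpha * ediam (X nu))) XX (V theta X alpha).
Proof.
move=> u v Xu Xv; rewrite !V_ybest//.
have Hu := Psi_lipschitz Xu Xv (ybest_profiles Xu).
have := Psi_lipschitz Xv Xu (ybest_profiles Xv); rewrite (enormBC v u) => Hv.
have Puv := Psi_le Xv (ybest_profiles Xu); have Pvu := Psi_le Xu (ybest_profiles Xv).
rewrite ler_norml lerNl opprB; apply/andP; split.
  exact: le_trans (lerB (lexx _) Pvu) Hv.
exact: le_trans (lerB (lexx _) Puv) Hu.
Qed.

(* The vector alpha (x - y) - g is z - P z up to the factor alpha, for P the projection onto
   the strategy set and z = x - g / alpha; since z - P z is nonexpansive in z, no Lipschitz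
   constant of the joint map ya is needed. *)
Lemma grad_V_lipschitz (Ly : R) u v :
  (forall nu, elipschitz Ly XX (yblock theta X alpha nu)) -> XX u -> XX v ->
  enorm (gradPsi u (ya u) - gradPsi v (ya v)) <=
  (\sum_nu (L1 nu + 2 * (L1 nu * Num.sqrt (1 + Ly ^+ 2))) + alpha) * enorm (u - v).
Proof.
move=> yL Xu Xv; have [->|uv] := eqVneq u v; first by rewrite !subrr !enorm0 mulr0.
set D := enorm (u - v); set s := Num.sqrt _.
have L1ge0 nu : 0 <= L1 nu.
  case: (theta_smooth nu) => _ /(_ u v Xu Xv).
  exact: lipschitz_const_ge0 uv (enorm_ge0 _).
pose dg nu := g nu (mix nu u (ya u)) - g nu (mix nu v (ya v)).
have dgL nu : enorm (dg nu) <= L1 nu * s * D.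
  case: (theta_smooth nu) => _ gL; apply: le_trans (gL _ _ _ _) _.
  - by apply: profiles_mix => //; exact: ybest_profiles.
  - by apply: profiles_mix => //; exact: ybest_profiles.
  - by rewrite -mulrA ler_wpM2l//; exact: enorm_mixB.
pose gam := \sum_nu bmask nu (dg nu).
(* [A] is [alpha] times the change of [z], and [B] that of [P z]; the summed monotonicity [AB] makes
   [A - B] no longer than [A]. *)
pose A := alpha *: (u - v) - gam; pose B := alpha *: (ya u - ya v).
have AB : 0 <= dot (A - B) B.
  rewrite dotZr mulr_ge0 ?(ltW alpha_gt0)//.
  have -> : A - B = \sum_nu bmask nu (alpha *: ((u - v) - (ya u - ya v)) - dg nu).
    transitivity (alpha *: ((u - v) - (ya u - ya v)) - gam).
      by rewrite /A /B [in RHS]scalerBr addrAC.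
    rewrite -[X in X - _]sum_bmask -sumrB.
    by apply: eq_bigr => nu _; rewrite [RHS]bmaskB.
  by rewrite dot_suml; apply: sumr_ge0 => nu _; exact: ybest_monotone.
have ABA := ler_enorm_monotone AB.
have gamL : enorm gam <= \sum_nu L1 nu * s * D.
  apply: le_trans (ler_enorm_sum _) _; apply: ler_sum => nu _.
  exact: le_trans (ler_enorm_bmask _ _) (dgL nu).
have -> : gradPsi u (ya u) - gradPsi v (ya v) =
    \sum_nu (g nu u - g nu v) - \sum_nu dg nu - (A - B).
  have gamE : gam = \sum_nu bmask nu (g nu (mix nu u (ya u))) -
      \sum_nu bmask nu (g nu (mix nu v (ya v))).
    by rewrite -sumrB; apply: eq_bigr => nu _; rewrite bmaskB.
  have subACA (x y z t : profile R n) : x - y - (z - t) = x - z - (y - t).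
    by rewrite opprD addrACA -opprD.
  have dgE : \sum_nu (g nu u - g nu v) - \sum_nu dg nu =
      \sum_nu (g nu u - g nu (mix nu u (ya u))) - \sum_nu (g nu v - g nu (mix nu v (ya v))).
    by rewrite -!sumrB; apply: eq_bigr => nu _; rewrite subACA.
  rewrite (gradPsiE u) (gradPsiE v) subACA [X in _ + X - _ = _]opprD addrACA -gamE -dgE -addrA.
  congr (_ + _); rewrite -scalerBr subACA scalerBr [A - B]addrAC.
  by rewrite [RHS]opprB.
apply: le_trans (ler_enormB _ _) _; apply: le_trans (lerD (ler_enormB _ _) ABA) _.
(* The term [L1 nu * s] will count twice: once for the full gradients at the deviated points, once
   inside [A]. *)
have S1 : enorm (\sum_nu (g nu u - g nu v)) <= \sum_nu L1 nu * D.
  apply: le_trans (ler_enorm_sum _) _; apply: ler_sum => nu _.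
  by case: (theta_smooth nu) => _; apply.
have S2 : enorm (\sum_nu dg nu) <= \sum_nu L1 nu * s * D.
  by apply: le_trans (ler_enorm_sum _) _; exact: ler_sum.
have SA : enorm A <= alpha * D + \sum_nu L1 nu * s * D.
  apply: le_trans (ler_enormB _ _) _; rewrite enormZ (gtr0_norm alpha_gt0).
  by rewrite lerD2l.
have -> : (\sum_nu (L1 nu + 2 * (L1 nu * s)) + alpha) * D =
    \sum_nu L1 nu * D + 2 * (\sum_nu L1 nu * s * D) + alpha * D.
  rewrite mulrDl mulr_suml mulr_sumr -big_split /=; congr (_ + _).
  by apply: eq_bigr => nu _; ring.
apply: le_trans (lerD (lerD S1 S2) SA) _.
have swap3 (x y z : R) : x + y + (z + y) = x + 2 * y + z by ring.
by rewrite swap3.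
Qed.

End Game.

(** * Assembly of the claims, where the sharper constants are weakened to the stated ones *)

Theorem proposition2p8 (R : realType) (N : nat) (n : 'I_N -> nat)
    (X : forall nu : 'I_N, set 'rV[R]_(n nu))
    (theta : 'I_N -> profile R n -> R)
    (L0 L1 : 'I_N -> R) (alpha : R)
    (X_compact : forall nu, compact (X nu))
    (X_convex : forall nu, convex_set (X nu))
    (theta_convex : forall nu, player_convex X nu (theta nu))
    (theta_lipschitz : forall nu, elipschitz_fun (L0 nu) (profiles X) (theta nu))
    (theta_smooth : forall nu, smooth_on (L1 nu) (profiles X) (theta nu))
    (alpha_gt0 : 0 < alpha) :
  let XX := profiles X in
  let Va := V theta X alpha in
  let ya := ybest theta X alpha in
  [/\
    (* value of the Lipschitz constant of the map y_alpha^nu *)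
    forall (nu : 'I_N) (LG : R),
      elipschitz LG XX (fun x => submxrow (grad (theta nu) x) nu) ->
      LG < alpha ->
      elipschitz ((alpha + LG) / (alpha - LG)) XX (yblock theta X alpha nu),
    (* (i) *)
    forall x, XX x ->
      [/\ differentiable Va x,
          grad Va x = grad (fun x' => Psi theta alpha x' (ya x)) x
        & grad Va x =
            \sum_nu (grad (theta nu) x
                     - grad (theta nu) (deviate x (submxrow (ya x) nu)))
            + (\mxrow_nu
                 submxrow (grad (theta nu) (deviate x (submxrow (ya x) nu))) nu)
            - alpha *: (x - ya x)]
  & (* (ii) and (iii), for any common Lipschitz constant Ly of the maps y_alpha^nu *)
    forall Ly : R,
      (forall nu, elipschitz Ly XX (yblock theta X alpha nu)) ->
      elipschitz_fun
        (\sum_nu (L0 nu * (1 + Num.sqrt (1 + Ly ^+ 2))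
                  + 4 * alpha * ediam (X nu) * (1 + Ly))) XX Va
      /\
      elipschitz
        (2 * \sum_nu (L1 nu + L1 nu * Num.sqrt (1 + Ly ^+ 2))
         + alpha * (1 + Ly)) XX (grad Va) ].
Proof.
move=> XX Va ya.
have Vgrad x : XX x -> differentiable Va x /\ grad Va x = gradPsi theta alpha x (ya x).
  by move=> Xx; exact/has_grad_grad/V_has_grad.
split=> [nu LG gL LGa|x Xx|Ly yL]; first exact: yblock_lipschitz.
  have [dV gV] := Vgrad x Xx.
  have Xy : XX (ya x) by exact: ybest_profiles.
  split=> //; rewrite gV.
    have := joint_grad_has_grad (Psi_joint_grad alpha theta_smooth Xx Xy).
    by case/has_grad_grad.
  have -> : \mxrow_nu submxrow (grad (theta nu) (deviate x (submxrow (ya x) nu))) nu =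
      \sum_nu bmask nu (grad (theta nu) (mix nu x (ya x))).
    by rewrite sum_bmask_mxrow; apply: eq_mxrow => nu; rewrite deviate_submxrow.
  by rewrite gradPsiE -(eq_bigr _ (fun nu _ => congr1 (fun p => grad (theta nu) x - grad (theta nu) p)
    (deviate_submxrow nu x (ya x)))).
split=> u v Xu Xv.
  apply: le_trans (V_lipschitz X_compact X_convex theta_convex theta_lipschitz
    theta_smooth alpha_gt0 Xu Xv) _.
  have [->|uv] := eqVneq u v; first by rewrite subrr enorm0 !mulr0.
  rewrite ler_wpM2r ?enorm_ge0//; apply: ler_sum => nu _.
  have L0ge0 : 0 <= L0 nu := lipschitz_const_ge0 uv (normr_ge0 _) (theta_lipschitz nu u v Xu Xv).
  have Ly0 : 0 <= Ly := lipschitz_const_ge0 uv (enorm_ge0 _) (yL nu u v Xu Xv).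
  have C0 : 0 <= ediam (X nu).
    exact: le_trans (enorm_ge0 _) (ler_ediam X_compact (Xu nu) (Xu nu)).
  apply: lerD.
    (* The factor 2 is at most [1 + Num.sqrt (1 + Ly ^+ 2)], as the root is at least 1. *)
    rewrite ler_wpM2l// (natrD _ 1 1) lerD2l -[leLHS]sqrtr1 ler_wsqrtr//.
    by rewrite lerDl sqr_ge0.
  have : 0 <= alpha * ediam (X nu) by rewrite mulr_ge0// ltW.
  have : 0 <= alpha * ediam (X nu) * Ly by rewrite !mulr_ge0// ltW.
  lra.
have [_ ->] := Vgrad u Xu; have [_ ->] := Vgrad v Xv.
apply: le_trans (grad_V_lipschitz X_compact X_convex theta_smooth alpha_gt0 yL Xu Xv) _.
have [->|uv] := eqVneq u v; first by rewrite subrr enorm0 !mulr0.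
rewrite ler_wpM2r ?enorm_ge0// mulr_sumr lerD//.
  apply: ler_sum => nu _; rewrite mulrDr lerD2r.
  have L1ge0 : 0 <= L1 nu.
    by case: (theta_smooth nu) => _ /(_ u v Xu Xv); exact: lipschitz_const_ge0 uv (enorm_ge0 _).
  lra.
(* A player exists because u and v differ; without players Ly would be unconstrained. *)
have [nu _] : exists nu : 'I_N, true.
  apply: contra_notP (negP uv) => noN; apply/eqP/rowP => i.
  by exfalso; apply: noN; exists (tagnat.sig1 i).
have Ly0 : 0 <= Ly := lipschitz_const_ge0 uv (enorm_ge0 _) (yL nu u v Xu Xv).
have : 0 <= alpha * Ly by rewrite mulr_ge0// ltW.
lra.
Qed.
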